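(* Let $L\in C^\infty(T^nM)$. If a holonomic measure $\mu$ on $T^nM$ is critical (for $A_L$) with respect to all transpositional variations, then for every $i=1,\dots,n$ the support of $\mu$ is a subset of the set of points $(x,v_1,\dots,v_n)\in T^nM$ where $$g(v_i,\nabla_{v_i}L)-L=-A_L(\mu).$$
   Context: $M$ is a compact oriented $C^\infty$ manifold without boundary, of dimension $d\ge1$, with a fixed Riemannian metric $g$; $1\le n\le d$. $T^nM=TM\oplus\cdots\oplus TM$ ($n$ copies), with elements $(x,v_1,\dots,v_n)$, $v_i\in T_xM$. $\Omega^k(M)$ is the space of smooth $k$-forms; $n$-forms are regarded as functions on $T^nM$. For $\omega\in\Omega^n(M)$ put $\|\omega\|=\sup\{\omega_x(v_1,\dots,v_n): x\in M,\ |v_i|\le1\}$ and $\operatorname{vol}_n(v_1,\dots,v_n)=\sup_{\|\omega\|\le1}\omega_x(v_1,\dots,v_n)$. A positive Borel measure $\mu$ on $T^nM$ is mild if $\int\operatorname{vol}_n\,d\mu<\infty$. A mild measure is holonomic if it is a probability measure and $\int d\omega\,d\mu=0$ for all $\omega\in\Omega^{n-1}(M)$. The action is $A_L(\mu)=\int_{T^nM}L\,d\mu$, assumed to be finite. The gradient $\nabla_{v_i}f$ of a function $f$ on $T^nM$ is defined by $g(u_i,\nabla_{v_i}f)=\lim_{t\to0}\frac{f(x,v_1,\dots,v_i+tu_i,\dots,v_n)-f(x,v_1,\dots,v_n)}{t}$. For $\sigma\in C^\infty_c(T^nM)$ and $1\le i\le n$, let $\eta_{\sigma,i}$ be the distribution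 $\langle\eta_{\sigma,i},f\rangle=\int\sigma f\,d\mu-\int\sigma\,g(v_i,\nabla_{v_i}f)\,d\mu-\int f\,d\mu\int\sigma\,d\mu$. The measure $\mu$ is critical with respect to all transpositional variations if $\langle\eta_{\sigma,i},L\rangle\ge0$ for all $\sigma\in C^\infty_c(T^nM)$ and all $1\le i\le n$ (equivalently $=0$, since $\sigma$ may be replaced by $-\sigma$), where $\langle\eta_{\sigma,i},L\rangle$ is given by the same formula with $f=L$. *)

(* Defs.v *)
From HB Require Import structures.
From mathcomp Require Import all_boot all_order all_algebra.
From mathcomp Require Import all_classical all_reals all_analysis.

Set Implicit Arguments.
Unset Strict Implicit.
Unset Printing Implicit Defensive.

Import Order.TTheory GRing.Theory Num.Theory.
Import numFieldNormedType.Exports.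

Local Open Scope classical_set_scope.
Local Open Scope ring_scope.

(* [smooth_on D f] is meant for [D] open and [V], [W] finite-dimensional, where
   asking each directional differential ['d f x v] to be C^k amounts to asking
   the differential to be C^k. *)
Fixpoint Ck_on {R : realType} {V W : normedModType R} (k : nat) (D : set V)
    (f : V -> W) : Prop :=
  if k is k'.+1 then
    (forall x, D x -> differentiable f x) /\
    (forall v, Ck_on k' D (fun x => 'd f x v))
  else forall x, D x -> {for x, continuous f}.

Definition smooth_on {R : realType} {V W : normedModType R} (D : set V)
    (f : V -> W) : Prop :=
  forall k, Ck_on k D f.

(* An oriented atlas on [M].  Compactness and the Hausdorff property of [M] are
   not included.  [chart_at x] is a preferred chart around [x]; it only serves
   to name tangent vectors by coordinates, see [tbundle]. *)
Record oriented_manifold (R : realType) (d : nat) (M : topologicalType) :=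
  OrientedManifold {
  chart_index : Type ;
  chart_dom : chart_index -> set M ;
  chart : chart_index -> M -> 'rV[R]_d ;
  chart_inv : chart_index -> 'rV[R]_d -> M ;
  chart_at : M -> chart_index ;
  chart_dom_open : forall i, open (chart_dom i) ;
  chart_at_dom : forall x, chart_dom (chart_at x) x ;
  chart_img_open : forall i, open (chart i @` chart_dom i) ;
  chartK : forall i x, chart_dom i x -> chart_inv i (chart i x) = x ;
  chart_continuous : forall i x, chart_dom i x -> {for x, continuous (chart i)} ;
  chart_inv_continuous : forall i y, (chart i @` chart_dom i) y ->
    {for y, continuous (chart_inv i)} ;
  transition_smooth : forall i j,
    smooth_on (chart i @` (chart_dom i `&` chart_dom j))
              (chart j \o chart_inv i) ;
  transition_oriented : forall i j y,
    (chart i @` (chart_dom i `&` chart_dom j)) y ->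
    0 < \det (jacobian (chart j \o chart_inv i) y)
}.

Definition chart_img {R : realType} {d : nat} {M : topologicalType}
    (S : oriented_manifold R d M) (i : chart_index S) : set 'rV[R]_d :=
  chart i @` chart_dom i.

(* The tangent space at [x] is identified with R^d through the coordinates of
   the preferred chart [chart_at S x].  [frame i y] changes coordinates at the
   point [chart_inv i y]: a tangent vector whose (row) coordinates in the chart
   [i] are [v] has coordinates [v *m frame i y] in the preferred chart. *)
Definition frame {R : realType} {d : nat} {M : topologicalType}
    (S : oriented_manifold R d M) (i : chart_index S) (y : 'rV[R]_d) : 'M[R]_d :=
  jacobian (chart (chart_at S (chart_inv i y)) \o chart_inv i) y.

(* T^nM: the point [(x, A)] stands for (x, v_1, ..., v_n), the rows of [A] being
   the preferred coordinates of the v_k.  It does not carry the product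
   topology, since preferred charts may jump; see [tbundle_open]. *)
Definition tbundle {R : realType} {d : nat} {M : topologicalType}
    (S : oriented_manifold R d M) (n : nat) : Type := (M * 'M[R]_(n, d))%type.

Definition tbundle_param {R : realType} {d : nat} {M : topologicalType}
    (S : oriented_manifold R d M) (n : nat) (i : chart_index S)
    (p : 'rV[R]_d * 'M[R]_(n, d)) : tbundle S n :=
  (chart_inv i p.1, p.2 *m frame i p.1).

Definition tbundle_open {R : realType} {d : nat} {M : topologicalType}
    (S : oriented_manifold R d M) (n : nat) : set (set (tbundle S n)) :=
  [set O | forall i : chart_index S,
     open [set p | chart_img i p.1 /\ O (tbundle_param i p)]].

Section TBundleTopology.
Variables (R : realType) (d : nat) (M : ptopologicalType).
Variables (S : oriented_manifold R d M) (n : nat).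

Let tbundle_openT : @tbundle_open R d M S n setT.
Proof.
move=> i; rewrite (_ : mkset _ = fst @^-1` chart_img i).
  by apply: open_comp => [p _|]; [exact: cvg_fst | exact: chart_img_open].
by apply/seteqP; split => p /=; [case | split].
Qed.

Let tbundle_openI : setI_closed (@tbundle_open R d M S n).
Proof.
move=> A B oA oB i; rewrite (_ : mkset _ =
  [set p | chart_img i p.1 /\ A (tbundle_param i p)] `&`
  [set p | chart_img i p.1 /\ B (tbundle_param i p)]).
  exact: openI.
by apply/seteqP; split => p /=; [move=> [? [? ?]] | move=> [[? ?] [? ?]]].
Qed.

Let tbundle_open_bigU (I : Type) (f : I -> set (tbundle S n)) :
  (forall a, tbundle_open (f a)) -> tbundle_open (\bigcup_a f a).
Proof.
move=> of_ i; rewrite (_ : mkset _ =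
  \bigcup_a [set p | chart_img i p.1 /\ f a (tbundle_param i p)]).
  by apply: bigcup_open => a _; exact: of_.
apply/seteqP; split => p /=.
  by move=> [? [a _ ?]]; exists a.
by move=> [a _ [? ?]]; split => //; exists a.
Qed.

HB.instance Definition _ :=
  Pointed.copy (tbundle S n) (M * 'M[R]_(n, d))%type.
HB.instance Definition _ := isOpenTopological.Build (tbundle S n)
  tbundle_openT tbundle_openI tbundle_open_bigU.

End TBundleTopology.

Definition smooth_fun {R : realType} {d : nat} {M : ptopologicalType}
    {S : oriented_manifold R d M} {n : nat} (f : tbundle S n -> R) : Prop :=
  forall i : chart_index S,
    smooth_on [set p | chart_img i p.1] (f \o tbundle_param i).

Definition smooth_compact_support {R : realType} {d : nat}
    {M : ptopologicalType} {S : oriented_manifold R d M} {n : nat}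
    (f : tbundle S n -> R) : Prop :=
  smooth_fun f /\ compact (closure [set z | f z != 0]).

(* [gram x] is the Gram matrix of g_x in preferred coordinates; the matrix in
   [gram_smooth] is the one in the coordinates of the chart [i]. *)
Record riemannian_metric {R : realType} {d : nat} {M : ptopologicalType}
    (S : oriented_manifold R d M) := RiemannianMetric {
  gram : M -> 'M[R]_d ;
  gram_sym : forall x, (gram x)^T = gram x ;
  gram_posdef : forall x (u : 'rV[R]_d), u != 0 ->
    0 < (u *m gram x *m u^T) 0 0 ;
  gram_smooth : forall i : chart_index S,
    smooth_on (chart_img i)
      (fun y => frame i y *m gram (chart_inv i y) *m (frame i y)^T)
}.

Definition inner {R : realType} {d : nat} {M : ptopologicalType}
    {S : oriented_manifold R d M} (g : riemannian_metric S)
    (x : M) (u v : 'rV[R]_d) : R :=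
  (u *m gram g x *m v^T) 0 0.

Definition gnorm {R : realType} {d : nat} {M : ptopologicalType}
    {S : oriented_manifold R d M} (g : riemannian_metric S)
    (x : M) (u : 'rV[R]_d) : R :=
  Num.sqrt (inner g x u u).

(* Multilinearity and alternation in the rows are phrased as for [\det]
   (cf. [determinant_multilinear], [determinant_alternate]); [form_smooth] asks
   for smooth coefficients in every chart. *)
Record diff_form {R : realType} {d : nat} {M : ptopologicalType}
    (S : oriented_manifold R d M) (k : nat) := DiffForm {
  form_fun :> tbundle S k -> R ;
  form_multilinear : forall (x : M) (A B C : 'M[R]_(k, d)) (i0 : 'I_k) (b c : R),
    row i0 A = b *: row i0 B + c *: row i0 C ->
    row' i0 B = row' i0 A -> row' i0 C = row' i0 A ->
    form_fun (x, A) = b * form_fun (x, B) + c * form_fun (x, C) ;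
  form_alternate : forall (x : M) (A : 'M[R]_(k, d)) (i1 i2 : 'I_k),
    i1 != i2 -> row i1 A = row i2 A -> form_fun (x, A) = 0 ;
  form_smooth : forall (i : chart_index S) (A : 'M[R]_(k, d)),
    smooth_on (chart_img i) (fun y => form_fun (tbundle_param i (y, A)))
}.

(* Exterior derivative from (k-1)-forms to k-forms, for k > 0, computed in the
   preferred chart, where the rows of [z.2] extend to constant vector fields:
   d w (v_0, ..., v_(k-1)) =
     \sum_j (-1)^j D_(v_j) (w (v_0, ..., v_(j-1), v_(j+1), ..., v_(k-1))). *)
Definition ext_deriv {R : realType} {d : nat} {M : ptopologicalType}
    {S : oriented_manifold R d M} {k : nat} (w : diff_form S k.-1)
    (z : tbundle S k) : R :=
  \sum_(j < k) (-1) ^+ j *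
    'D_(row j z.2)
      (fun y : 'rV[R]_d =>
         w (tbundle_param (chart_at S z.1) (y, row' j z.2)) : R^o)
      (chart (chart_at S z.1) z.1).

Definition comass {R : realType} {d : nat} {M : ptopologicalType}
    {S : oriented_manifold R d M} (g : riemannian_metric S) {n : nat}
    (w : diff_form S n) : \bar R :=
  ereal_sup [set (w z)%:E | z in
    [set z : tbundle S n | forall i : 'I_n, gnorm g z.1 (row i z.2) <= 1]].

Definition vol {R : realType} {d : nat} {M : ptopologicalType}
    {S : oriented_manifold R d M} (g : riemannian_metric S) {n : nat}
    (z : tbundle S n) : \bar R :=
  ereal_sup [set (w z)%:E | w in
    [set w : diff_form S n | (comass g w <= 1)%E]].

Notation borel_tbundle S n := (g_sigma_algebraType (@open (tbundle S n))).

Definition mild {R : realType} {d : nat} {M : ptopologicalType}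
    {S : oriented_manifold R d M} (g : riemannian_metric S) {n : nat}
    (mu : {measure set (borel_tbundle S n) -> \bar R}) : Prop :=
  (\int[mu]_z vol g (z : tbundle S n) < +oo)%E.

Definition holonomic {R : realType} {d : nat} {M : ptopologicalType}
    {S : oriented_manifold R d M} (g : riemannian_metric S) {n : nat}
    (mu : {measure set (borel_tbundle S n) -> \bar R}) : Prop :=
  [/\ mild g mu,
      mu setT = 1%E &
      forall w : diff_form S n.-1,
        (\int[mu]_z (ext_deriv w (z : tbundle S n))%:E = 0)%E].

Definition action {R : realType} {d : nat} {M : ptopologicalType}
    {S : oriented_manifold R d M} {n : nat}
    (mu : {measure set (borel_tbundle S n) -> \bar R})
    (L : tbundle S n -> R) : R :=
  \int[mu]_z L z.

(* The gradient of [f] in v_i at [z], i.e. the vector representing, with respect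
   to g, the derivative of [f] in the direction moving only the row [i]. *)
Definition vgrad {R : realType} {d : nat} {M : ptopologicalType}
    {S : oriented_manifold R d M} (g : riemannian_metric S) {n : nat}
    (i : 'I_n) (f : tbundle S n -> R) (z : tbundle S n) : 'rV[R]_d :=
  xget 0 [set w : 'rV[R]_d | forall u : 'rV[R]_d,
    inner g z.1 u w =
    'D_(delta_mx i 0 *m u) (fun A : 'M[R]_(n, d) => f (z.1, A) : R^o) z.2].

Definition transp_variation {R : realType} {d : nat} {M : ptopologicalType}
    {S : oriented_manifold R d M} (g : riemannian_metric S) {n : nat}
    (mu : {measure set (borel_tbundle S n) -> \bar R})
    (s : tbundle S n -> R) (i : 'I_n) (f : tbundle S n -> R) : R :=
  \int[mu]_z (s z * f z)
  - \int[mu]_z (s z * inner g (z : tbundle S n).1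
                        (row i (z : tbundle S n).2) (vgrad g i f z))
  - (\int[mu]_z f z) * (\int[mu]_z s z).

Definition transp_critical {R : realType} {d : nat} {M : ptopologicalType}
    {S : oriented_manifold R d M} (g : riemannian_metric S) {n : nat}
    (mu : {measure set (borel_tbundle S n) -> \bar R})
    (L : tbundle S n -> R) : Prop :=
  forall (s : tbundle S n -> R) (i : 'I_n),
    smooth_compact_support s -> 0 <= transp_variation g mu s i L.

Definition measure_support {R : realType} {d : nat} {M : ptopologicalType}
    {S : oriented_manifold R d M} {n : nat}
    (mu : {measure set (borel_tbundle S n) -> \bar R}) : set (tbundle S n) :=
  [set z | forall U : set (tbundle S n), open U -> U z -> (0 < mu U)%E].

(* Main.v *)
Require Import Defs.
From HB Require Import structures.
From mathcomp Require Import all_boot all_order all_algebra.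
From mathcomp Require Import all_classical all_reals all_analysis.
From mathcomp Require Import ring lra.

Set Implicit Arguments.
Unset Strict Implicit.
Unset Printing Implicit Defensive.

Import Order.TTheory GRing.Theory Num.Theory.
Import numFieldNormedType.Exports.

Local Open Scope classical_set_scope.
Local Open Scope ring_scope.

(** The gradient in [v_i] enters the statement only through its inner product
    with [v_i] itself, and that number is the derivative of [L] when [v_i] alone
    is rescaled ([euler], [inner_vgradE]).  Let F = L - euler i L - A with A the
    action.  Then the variation generated by a test function s is the integral
    of s F ([transp_variationE]), and the claim is that F vanishes on the support
    of the measure.

    Read in a chart, [euler i L] is a polynomial in the vectors whose
    coefficients are partial derivatives of [L], so F is continuous
    ([euler_continuous]).  If F were nonzero at a point z of the support, it would
    keep its sign on a neighbourhood of z.  A nonnegative bump function supported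
    there and positive at z, taken with the sign opposite to that of F, is a test
    function whose variation is negative ([Rintegral_gt0]): this contradicts
    criticality.  The support of the measure is what makes the inequality strict,
    and the total mass being finite is what makes the bounded integrands
    integrable, so that the variation is a single integral.

    The substance is the existence of bump functions on T^nM ([exists_bump]).
    Such a function is exp(-1/t) composed with a polynomial in the coordinates of
    one chart c, extended by zero.  To see that it is smooth in another chart one
    writes the coordinates of c there: they are the transition map and its
    Jacobian acting on the vectors ([local_coord_transition]).  The extension by
    zero is smooth since the carrier of the bump is closed in T^nM
    ([closed_bump_carrier]), which is where the Hausdorff property is used.
    All smoothness proofs reduce to sums and products of real-valued functions,
    so a chain rule for C^k maps between vector spaces is avoided. *)

(** * Calculus of C^k functions *)

Section CkCalculus.
Context {R : realType}.

Lemma near_eq_differentiable {V W : normedModType R} (f g : V -> W) (x : V) :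
  {near x, f =1 g} -> differentiable f x ->
  differentiable g x /\ 'd g x = 'd f x :> (V -> W).
Proof.
move=> fg df; have gE : g \o shift x = cst (g x) + 'd f x +o_ 0 id.
  have /eqaddoP fo := diff_locally df.
  apply/eqaddoP => e e0; have := fo _ e0.
  rewrite -(nbhs_singleton fg) => {}fo.
  have fg0 : \forall h \near 0, f (h + x) = g (h + x).
    by move: fg; rewrite (near_shift 0 x) /= subr0.
  near=> h; rewrite !fctE /=; rewrite -(near fg0 h) //.
  exact: (near fo h).
have dfc := diff_continuous df; have dgE := diff_unique dfc gE.
by split=> //; apply/diff_locallyP; rewrite dgE.
Unshelve. all: by end_near. Qed.

(** Openness of [D] makes the agreement of [f] and [g] local at every point, so
    that it passes to the differentials and the induction on [k] goes on. *)
Lemma Ck_on_eq {V W : normedModType R} k (D : set V) (f g : V -> W) :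
  open D -> (forall x, D x -> f x = g x) -> Ck_on k D f -> Ck_on k D g.
Proof.
move=> oD; have nD x (P : V -> Prop) : D x -> (forall y, D y -> P y) ->
    \forall y \near x, P y.
  by by move=> Dx DP; apply: filterS DP _; exact: open_nbhs_nbhs.
elim: k f g => [|k IH] f g fg /=.
  move=> fc x Dx; rewrite /prop_for /continuous_at -(fg _ Dx).
  apply: cvg_trans (fc _ Dx); apply: near_eq_cvg.
  by apply: nD Dx _ => y /fg.
move=> [fd fk]; split => [x Dx|v].
  by have [] := near_eq_differentiable (nD _ _ Dx fg) (fd _ Dx).
apply: IH (fk v) => x Dx.
by have [_ ->] := near_eq_differentiable (nD _ _ Dx fg) (fd _ Dx).
Qed.

Lemma Ck_onS {V W : normedModType R} k (D E : set V) (f : V -> W) :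
  E `<=` D -> Ck_on k D f -> Ck_on k E f.
Proof.
move=> ED; elim: k f => [|k IH] f /=; first by move=> h x /ED/h.
by move=> [fd fk]; split=> [x /ED/fd//|v]; exact: IH.
Qed.

(** Each clause of [Ck_on] speaks of one point of the domain at a time.  Hence
    smoothness can be checked separately on the pieces of a cover, which is how a
    function defined by cases is shown to be smooth. *)
Lemma Ck_on_setU {V W : normedModType R} k (D E : set V) (f : V -> W) :
  Ck_on k D f -> Ck_on k E f -> Ck_on k (D `|` E) f.
Proof.
elim: k f => [|k IH] f /=; first by move=> h1 h2 x [/h1|/h2].
by move=> [h1 h2] [h3 h4]; split=> [x [/h1|/h3]|v] //; exact: IH.
Qed.

Lemma Ck_onW {V W : normedModType R} k (D : set V) (f : V -> W) :
  Ck_on k.+1 D f -> Ck_on k D f.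
Proof.
elim: k f => [|k IH] f; first by move=> [fd _] x /fd/differentiable_continuous.
by move=> [fd fk]; split=> // v; exact/IH/fk.
Qed.

Lemma Ck_on_cst {V W : normedModType R} k (D : set V) (a : W) :
  open D -> Ck_on k D (fun _ => a).
Proof.
move=> oD; elim: k a => [|k IH] a; first by move=> x _; exact: cvg_cst.
split=> [x _|v]; first exact: differentiable_cst.
by apply: (Ck_on_eq oD _ (IH 0)) => x _; rewrite diff_cst.
Qed.

Lemma Ck_on_linear {V W : normedModType R} k (D : set V)
    (l : {linear V -> W}) : open D -> continuous l -> Ck_on k D l.
Proof.
move=> oD lc; case: k => [|k] /=; first by move=> x _; exact: lc.
split=> [x _|v]; first exact: linear_differentiable.
by apply: (Ck_on_eq oD _ (Ck_on_cst k (l v) oD)) => x _; rewrite diff_lin.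
Qed.

Lemma Ck_onD {V W : normedModType R} k (D : set V) (f g : V -> W) :
  open D -> Ck_on k D f -> Ck_on k D g -> Ck_on k D (fun x => f x + g x).
Proof.
move=> oD; elim: k f g => [|k IH] f g.
  by move=> fc gc x Dx; apply: cvgD; [exact: fc|exact: gc].
move=> [fd fk] [gd gk]; split=> [x Dx|v].
  by apply: differentiableD; [exact: fd|exact: gd].
apply: (Ck_on_eq oD _ (IH _ _ (fk v) (gk v))) => x Dx.
exact: (esym (congr1 (@^~ v) (diffD (fd _ Dx) (gd _ Dx)))).
Qed.

Lemma Ck_onM {V : normedModType R} k (D : set V) (f g : V -> R) :
  open D -> Ck_on k D f -> Ck_on k D g -> Ck_on k D (fun x => f x * g x).
Proof.
move=> oD; elim: k f g => [|k IH] f g.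
  by move=> fc gc x Dx; apply: cvgM; [exact: fc|exact: gc].
move=> fC gC; have [fW gW] := (Ck_onW fC, Ck_onW gC).
case: fC gC => [fd fk] [gd gk]; split=> [x Dx|v].
  by apply: differentiableM; [exact: fd|exact: gd].
apply: (Ck_on_eq oD _ (Ck_onD oD (IH _ _ fW (gk v)) (IH _ _ gW (fk v)))) => x Dx.
exact: (esym (congr1 (@^~ v) (diffM (fd _ Dx) (gd _ Dx)))).
Qed.

Lemma Ck_on_sum {V : normedModType R} k (D : set V) (I : Type) (r : seq I)
    (F : I -> V -> R) :
  open D -> (forall i, Ck_on k D (F i)) ->
  Ck_on k D (fun x => \sum_(i <- r) F i x).
Proof.
move=> oD Fk; elim: r => [|i r IH].
  by apply: (Ck_on_eq oD _ (Ck_on_cst k 0 oD)) => x _; rewrite big_nil.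
by apply: (Ck_on_eq oD _ (Ck_onD oD (Fk i) IH)) => x _; rewrite big_cons.
Qed.

Lemma Ck_on_comp_linear {V W X : normedModType R} k (D : set V)
    (l : {linear W -> X}) (f : V -> W) : open D -> continuous l ->
  Ck_on k D f -> Ck_on k D (l \o f).
Proof.
move=> oD lc; elim: k f => [|k IH] f.
  by move=> fc x Dx; apply: continuous_comp; [exact: fc|exact: lc].
have ld y : differentiable l y by exact: linear_differentiable.
move=> [fd fk]; split=> [x Dx|v].
  by apply: differentiable_comp; [exact: fd|exact: ld].
apply: (Ck_on_eq oD _ (IH _ (fk v))) => x Dx.
by rewrite (diff_comp (fd _ Dx) (ld _)) /= diff_lin.
Qed.

Lemma Ck_on_linear_comp {U V W : normedModType R} k (D : set V)
    (l : {linear U -> V}) (f : V -> W) : open D -> continuous l ->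
  Ck_on k D f -> Ck_on k (l @^-1` D) (f \o l).
Proof.
move=> oD lc; have oE : open (l @^-1` D) by apply: open_comp => // x _; exact: lc.
elim: k f => [|k IH] f.
  by move=> fc x Dx; apply: continuous_comp; [exact: lc|exact: fc].
have ld y : differentiable l y by exact: linear_differentiable.
move=> [fd fk]; split=> [x Dx|v].
  by apply: differentiable_comp; [exact: ld|exact: fd].
apply: (Ck_on_eq oE _ (IH _ (fk (l v)))) => x Dx.
by rewrite (diff_comp (ld _) (fd _ Dx)) /= diff_lin.
Qed.

(** The outer function has one real variable, so the differential of [p \o f]
    along [v] is the product of [p'] at [f x] with the differential of [f] along
    [v]: the induction only meets the product rule and [p'] in place of [p]. *)
Lemma Ck_on_comp_scalar {V : normedModType R} k (D : set V)
    (p : R -> R) (f : V -> R) : open D ->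
  smooth_on setT p -> Ck_on k D f -> Ck_on k D (p \o f).
Proof.
move=> oD; elim: k p f => [|k IH] p f pC.
  by move=> fc x Dx; apply: continuous_comp; [exact: fc|exact: (pC 0)].
have [pd _] := pC 1; have pC' : smooth_on setT (fun t => 'd p t 1).
  by move=> j; case: (pC j.+1) => _; apply.
move=> fC; have fW := Ck_onW fC; case: fC => [fd fk]; split=> [x Dx|v].
  by apply: differentiable_comp; [exact: fd|exact: pd].
apply: (Ck_on_eq oD _ (Ck_onM oD (fk v) (IH _ _ pC' fW))) => x Dx /=.
rewrite (diff_comp (fd _ Dx) (pd _ _)) //=.
by rewrite -[in RHS](mulr1 ('d f x v)) linearZ.
Qed.

End CkCalculus.

(** * Coordinate functions and cubes *)

Section Coordinates.
Context {R : realType}.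

Lemma Ck_on_coord {V : normedModType R} {m n : nat} k (D : set V)
    (f : V -> 'M[R]_(m, n)) (a : 'I_m) (b : 'I_n) :
  open D -> Ck_on k D f -> Ck_on k D (fun x => f x a b).
Proof.
move=> oD fk; have lin : linear (fun A : 'M[R]_(m, n) => A a b : R).
  by move=> t A B; rewrite !mxE.
pose l : {linear 'M[R]_(m, n) -> R} :=
  HB.pack (fun A : 'M[R]_(m, n) => A a b) (GRing.isLinear.Build _ _ _ _ _ lin).
have lc : continuous l by exact: coord_continuous.
exact: (Ck_on_comp_linear oD lc fk).
Qed.

Lemma Ck_on_fst {V V' W : normedModType R} k (D : set V) (f : V -> W) :
  open D -> Ck_on k D f ->
  Ck_on k [set p : V * V' | D p.1] (fun p : V * V' => f p.1).
Proof.
move=> oD fk; have lin : linear (fst : V * V' -> V) by [].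
pose l : {linear (V * V')%type -> V} :=
  HB.pack (fst : V * V' -> V) (GRing.isLinear.Build _ _ _ _ _ lin).
have lc : continuous l by move=> p; exact: cvg_fst.
exact: (Ck_on_linear_comp oD lc fk).
Qed.

Lemma Ck_on_snd {V V' : normedModType R} k (D : set (V * V')) :
  open D -> Ck_on k D (snd : V * V' -> V').
Proof.
move=> oD; have lin : linear (snd : V * V' -> V') by [].
pose l : {linear (V * V')%type -> V'} :=
  HB.pack (snd : V * V' -> V') (GRing.isLinear.Build _ _ _ _ _ lin).
have lc : continuous l by move=> p; exact: cvg_snd.
exact: (Ck_on_linear k oD lc).
Qed.

Lemma Ck_onB {V : normedModType R} k (D : set V) (f g : V -> R) :
  open D -> Ck_on k D f -> Ck_on k D g -> Ck_on k D (fun x => f x - g x).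
Proof.
move=> oD fk gk.
have := Ck_onD oD fk (Ck_onM oD (Ck_on_cst k (-1 : R) oD) gk).
by apply: Ck_on_eq => // x _; rewrite mulN1r.
Qed.

Lemma Ck_onX2 {V : normedModType R} k (D : set V) (f : V -> R) :
  open D -> Ck_on k D f -> Ck_on k D (fun x => f x ^+ 2).
Proof. by move=> oD fk; apply: Ck_on_eq (Ck_onM oD fk fk). Qed.

Lemma vec_mx_continuous m n : continuous (@vec_mx R m n).
Proof.
move=> v A [P vP PA].
have near_entry i j : \forall w \near v, P i j (vec_mx w i j).
  have := vP i j; rewrite mxE => Pij.
  have := @coord_continuous _ 1 (m * n) 0 (mxvec_index i j) v (P i j) Pij.
  by apply: (@filterS _ _ (nbhs_filter v)) => w /=; rewrite mxE.
have near_row i := @filter_forall _ _ _ _ (nbhs_filter v) (near_entry i).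
have near_all := @filter_forall _ _ _ _ (nbhs_filter v) near_row.
by apply: (@filterS _ _ (nbhs_filter v) _ _ _ near_all) => w wP; exact: PA.
Qed.

(** A cube of matrices is the reshaping of a cube of row vectors. *)
Lemma compact_mx_cube m n (A : 'M[R]_(m, n)) (r : R) :
  compact [set B : 'M[R]_(m, n) | forall i j, `|B i j - A i j| <= r].
Proof.
pose C := [set v : 'rV[R]_(m * n) | forall l,
  `[mxvec A 0 l - r, mxvec A 0 l + r]%classic (v ord0 l)].
have cC : compact C.
  by apply: (@rV_compact _ _ (fun l => `[mxvec A 0 l - r, mxvec A 0 l + r]%classic))
    => l; exact: segment_compact.
suff -> : [set B : 'M[R]_(m, n) | forall i j, `|B i j - A i j| <= r] =
    vec_mx @` C.
  apply: continuous_compact => //; apply: continuous_subspaceT.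
  exact: vec_mx_continuous.
apply/seteqP; split=> [B BA|_ [v vC <-] i j].
  exists (mxvec B); last by rewrite mxvecK.
  move=> l; case/mxvec_indexP: l => i j; rewrite !mxvecE /= in_itv /=.
  by rewrite -ler_distl.
have := vC (mxvec_index i j); rewrite /= in_itv /= -ler_distl.
by rewrite mxvecE mxE.
Qed.

End Coordinates.

(** * Functions flat at the origin *)

Section FlatFunctions.
Context {R : realType}.

(** [flat 0] is the usual exp(-1/t), extended by zero.  The factors t^(-m) are
    there because differentiation creates them: the whole family has to be
    treated at once. *)
Definition flat (m : nat) (t : R) : R :=
  if 0 < t then t^-1 ^+ m * expR (- t^-1) else 0.

(** With u = 1/t this is the estimate u^(m+1) / (m+1)! <= exp u.  It makes the
    difference quotients of every [flat m] at 0 tend to 0. *)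
Lemma flat_bound m (t : R) : `|flat m t| <= m.+1`!%:R * `|t|.
Proof.
rewrite /flat; case: ifPn => [t0|_]; last by rewrite normr0 mulr_ge0.
have u0 : 0 < t^-1 by rewrite invr_gt0.
rewrite ger0_norm; last by rewrite mulr_ge0 ?exprn_ge0 ?expR_ge0 ?ltW.
rewrite (gtr0_norm t0) expRN ler_pdivrMr ?expR_gt0//.
have fact0 : 0 < (m.+1`!)%:R :> R by rewrite ltr0n fact_gt0.
have h : t^-1 ^+ m.+1 <= m.+1`!%:R * expR t^-1.
  rewrite mulrC -ler_pdivrMr//.
  by apply: le_trans (expR_ge1Dxn m (ltW u0)); rewrite lerDr.
have -> : t^-1 ^+ m = t^-1 ^+ m.+1 * t by rewrite exprSr mulfVK ?gt_eqF.
by rewrite mulrAC ler_pM2r.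
Qed.

Lemma is_derive_flat m (t : R) :
  is_derive t 1 (flat m) (flat m.+2 t - m%:R * flat m.+1 t).
Proof.
have [t0|t0|->] := ltgtP t 0.
- rewrite /flat !ltNge (ltW t0) /= mulr0 subr0.
  apply: (near_eq_is_derive (f := cst 0)).
  by near=> x; rewrite /= ltNge ltW//=; near: x; exact: lt_nbhsl.
- pose F := (fun x : R => x^-1) ^+ m * (expR \o - (fun x : R => x^-1)).
  apply: (near_eq_is_derive (f := F)).
    near=> x; rewrite /flat ifT; first by rewrite /F exprfctE.
    near: x; exact: lt_nbhsr.
  have t_neq0 : t != 0 by rewrite gt_eqF.
  have dV : is_derive t 1 (fun x : R => x^-1) (- t^-1 ^+ 2).
    have := @is_deriveV R id t 1 1 t_neq0 (is_derive_id _ _).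
    by rewrite /= [_ *: _]mulr1 exprVn.
  have dX := @is_deriveX _ _ _ m _ _ _ dV.
  have dN := @is_deriveN _ _ _ _ _ _ _ dV.
  have dE := @is_derive1_comp _ expR _ t _ _ (is_derive_expR (- t^-1)) dN.
  have dF : is_derive t 1 F _ := is_deriveM dX dE.
  apply: (is_derive_eq dF); rewrite /flat t0 exprfctE /GRing.scale /=.
  case: m {F dX dF} => [|m]; first by rewrite expr0 !mul0r; ring.
  by rewrite !exprS /=; ring.
- have -> : flat m.+2 0 - m%:R * flat m.+1 0 = 0 :> R.
    by rewrite /flat ltxx mulr0 subrr.
  have lim0 : (h^-1 *: (flat m (h *: 1 + 0) - flat m 0)) @[h --> 0^'] --> (0 : R).
    apply/cvgr0Pnorm_lt => e e0; near=> h.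
    have h0 : h != 0 by near: h; exact: nbhs_dnbhs_neq.
    rewrite addr0 [h *: 1]mulr1 {2}/flat ltxx subr0 normrZ.
    (* the difference quotient at 0 is the next function of the family *)
    have -> : `|h^-1| * `|flat m h| = `|flat m.+1 h|.
      by rewrite -normrM /flat; case: ifP => _; rewrite ?mulr0// mulrA -exprS.
    apply: (le_lt_trans (flat_bound _ _)).
    rewrite mulrC -ltr_pdivlMr ?ltr0n ?fact_gt0//.
    by near: h; apply: dnbhs0_lt; rewrite divr_gt0 ?ltr0n ?fact_gt0.
  apply: DeriveDef; last exact/cvg_lim.
  by apply/cvg_ex; exists 0.
Unshelve. all: by end_near. Qed.

Lemma smooth_flat m : smooth_on setT (flat m).
Proof.
move=> k; have oT := @openT R; elim: k m => [|k IH] m /=.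
  move=> x _; apply: differentiable_continuous; apply/derivable1_diffP.
  by have [] := is_derive_flat m x.
have fd x : differentiable (flat m) x.
  by apply/derivable1_diffP; have [] := is_derive_flat m x.
split=> // v.
pose h x := v * (flat m.+2 x + (- m%:R) * flat m.+1 x).
apply: (@Ck_on_eq _ _ _ _ _ h) => // [x _|].
  have [_] := is_derive_flat m x; rewrite (deriveE _ (fd x)) /h mulNr => <-.
  by rewrite -[in RHS](mulr1 v) linearZ.
apply: (Ck_onM oT); first exact: Ck_on_cst.
apply: (Ck_onD oT); first exact: IH.
by apply: (Ck_onM oT); [exact: Ck_on_cst|exact: IH].
Qed.

Lemma flat0_gt0 (t : R) : 0 < t -> 0 < flat 0 t.
Proof. by move=> t0; rewrite /flat t0 expr0 mul1r expR_gt0. Qed.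

Lemma flat0_le0 (t : R) : t <= 0 -> flat 0 t = 0.
Proof. by move=> t0; rewrite /flat ltNge t0. Qed.

Lemma flat0_itv (t : R) : 0 <= flat 0 t <= 1.
Proof.
rewrite /flat; case: ifPn => [t0|_]; last by rewrite lexx ler01.
by rewrite expr0 mul1r expR_ge0 -expR0 ler_expR oppr_le0 invr_ge0 ltW.
Qed.

End FlatFunctions.

Lemma mul_jacobian {R : realType} {m n : nat} (f : 'rV[R]_m -> 'rV[R]_n)
    (y v : 'rV[R]_m) : v *m jacobian f y = 'd f y v.
Proof. by rewrite mul_rV_lin1. Qed.

(** * Charts, transition maps and frames *)

Section Charts.
Context {R : realType} {d : nat} {M : topologicalType}.
Variable S : oriented_manifold R d M.
Implicit Types (i j k : chart_index S) (x : M) (y : 'rV[R]_d).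

Lemma chart_imgP i y :
  chart_img i y -> chart_dom i (chart_inv i y) /\ chart i (chart_inv i y) = y.
Proof. by move=> [x Dx <-]; rewrite chartK. Qed.

Lemma chart_img_chart i x : chart_dom i x -> chart_img i (chart i x).
Proof. by move=> Dx; exists x. Qed.

Lemma open_chart_inv i (O : set M) :
  open O -> open [set y | chart_img i y /\ O (chart_inv i y)].
Proof.
move=> oO; rewrite openE => y [yi Oy]; rewrite /interior.
have : nbhs y (chart_img i) by apply: open_nbhs_nbhs; split=> //; exact: chart_img_open.
have : nbhs y (chart_inv i @^-1` O).
  by apply: (chart_inv_continuous yi); exact: open_nbhs_nbhs.
by apply: filterS2 => z Oz zi; split.
Qed.

Definition overlap i j : set 'rV[R]_d := chart i @` (chart_dom i `&` chart_dom j).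

Definition transition i j : 'rV[R]_d -> 'rV[R]_d := chart j \o chart_inv i.

Lemma overlapE i j :
  overlap i j = [set y | chart_img i y /\ chart_dom j (chart_inv i y)].
Proof.
apply/seteqP; split=> y /=.
  by move=> [x [xi xj] <-]; rewrite chartK//; split=> //; exists x.
by move=> [/chart_imgP[yi yK] yj]; exists (chart_inv i y).
Qed.

Lemma open_overlap i j : open (overlap i j).
Proof. by rewrite overlapE; apply: open_chart_inv; exact: chart_dom_open. Qed.

Lemma transition_overlap i j y : overlap i j y ->
  chart_inv j (transition i j y) = chart_inv i y /\
  chart_img j (transition i j y).
Proof.
rewrite overlapE => -[yi yj]; rewrite /transition /= chartK//; split=> //.
exact: chart_img_chart.
Qed.

Lemma transition_differentiable i j y :
  overlap i j y -> differentiable (transition i j) y.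
Proof. by move=> yij; have [+ _] := transition_smooth i j 1; apply. Qed.

Lemma frame_unit i y : chart_img i y -> frame i y \in unitmx.
Proof.
move=> yi; rewrite unitmxE unitfE gt_eqF//; apply: transition_oriented.
rewrite -/(overlap _ _) overlapE; split=> //; exact: chart_at_dom.
Qed.

(** Near [chart c x], with [c] the preferred chart of [x], going down and back
    up again is the identity. *)
Lemma frame_chart_at x : frame (chart_at S x) (chart (chart_at S x) x) = 1%:M.
Proof.
set c := chart_at S x; have xc : chart_dom c x by exact: chart_at_dom.
rewrite /frame chartK// -/c.
have E : {near chart c x, id =1 chart c \o chart_inv c}.
  have : nbhs (chart c x) (chart_img c).
    by apply: open_nbhs_nbhs; split; [exact: chart_img_open|exact: chart_img_chart].
  by apply: filterS => y /chart_imgP[_ /= ->].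
have [_ dE] := near_eq_differentiable E (@ex_diff _ _ _ _ _ _ _ (is_diff_id (chart c x))).
apply/row_matrixP => a; rewrite !rowE mul_rV_lin1 mulmx1 dE.
by rewrite diff_val.
Qed.

(** Both frames are differentials of transition maps towards the same preferred
    chart, namely that of the common base point, so this is the chain rule. *)
Lemma frame_transition i j y : overlap i j y ->
  frame i y = jacobian (transition i j) y *m frame j (transition i j y).
Proof.
move=> yij; have [invE tj] := transition_overlap yij.
rewrite /frame invE; set c := chart_at S _.
have tjc : overlap j c (transition i j y).
  by rewrite overlapE /= invE; split=> //; exact: chart_at_dom.
have tdij := transition_differentiable yij.
have tdjc := transition_differentiable tjc.
have E : {near y, transition j c \o transition i j =1 chart c \o chart_inv i}.
  have : nbhs y (overlap i j) by apply: open_nbhs_nbhs; split=> //; exact: open_overlap.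
  by apply: filterS => z /transition_overlap[zE _]; rewrite -[RHS]/(chart c (chart_inv i z)) -zE.
have [_ dE] := near_eq_differentiable E (differentiable_comp tdij tdjc).
apply/row_matrixP => a; rewrite !rowE mulmxA.
rewrite [LHS]mul_jacobian.
rewrite [X in _ = X *m _]mul_jacobian.
rewrite [RHS]mul_jacobian.
have /= E1 := congr1 (@^~ (delta_mx 0 a)) dE.
have /= E2 := congr1 (@^~ (delta_mx 0 a)) (diff_comp tdij tdjc).
by apply: (etrans E1); exact: E2.
Qed.

End Charts.

Section LocalCoordinates.
Context {R : realType} {d n : nat} {M : ptopologicalType}.
Variable S : oriented_manifold R d M.
Implicit Types (i j k : chart_index S) (z : tbundle S n).
Implicit Types (p : 'rV[R]_d * 'M[R]_(n, d)).

(** The inverse of [tbundle_param i] above the domain of the chart [i]. *)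
Definition local_coord i z : 'rV[R]_d * 'M[R]_(n, d) :=
  (chart i z.1, z.2 *m invmx (frame i (chart i z.1))).

Lemma local_coordK i z : chart_dom i z.1 -> tbundle_param i (local_coord i z) = z.
Proof.
case: z => x A /= xi; rewrite /tbundle_param /local_coord /= chartK//.
by rewrite mulmxKV// frame_unit//; exact: chart_img_chart.
Qed.

Lemma tbundle_paramK i p : chart_img i p.1 -> local_coord i (tbundle_param i p) = p.
Proof.
case: p => y B /= yi; have [_ yK] := chart_imgP yi.
by rewrite /local_coord /= yK mulmxK// frame_unit.
Qed.

Lemma local_coord_at z :
  local_coord (chart_at S z.1) z = (chart (chart_at S z.1) z.1, z.2).
Proof. by rewrite /local_coord frame_chart_at invmx1 mulmx1. Qed.

(** Changing charts acts on vectors by the differential of the transition map: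
    the two frames, which may jump with the preferred charts, cancel. *)
Lemma local_coord_transition i j p : overlap i j p.1 ->
  local_coord j (tbundle_param i p) =
  (transition i j p.1, p.2 *m jacobian (transition i j) p.1).
Proof.
case: p => y B /= yij; have [_ tj] := transition_overlap yij.
rewrite /local_coord /= -/(transition i j y) (frame_transition yij).
by rewrite mulmxA mulmxK// frame_unit.
Qed.

Lemma open_fst_preimage (D : set 'rV[R]_d) :
  open D -> open [set p : 'rV[R]_d * 'M[R]_(n, d) | D p.1].
Proof. by move=> oD; apply: open_comp => // p _; exact: cvg_fst. Qed.

Lemma open_tbundle_param i (O : set (tbundle S n)) :
  open O -> open [set p | chart_img i p.1 /\ O (tbundle_param i p)].
Proof. by move=> oO; exact: oO. Qed.

(** A subset of T^nM is open when its traces in the charts are. *)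
Lemma tbundle_continuous (f : tbundle S n -> R) :
  (forall i p, chart_img i p.1 -> {for p, continuous (f \o tbundle_param i)}) ->
  continuous f.
Proof.
move=> fc; apply/continuousP => A oA.
rewrite -[open _]/(tbundle_open (f @^-1` A)) => i.
rewrite openE => p [pi Ap]; rewrite /interior.
have : nbhs p [set q : 'rV[R]_d * 'M[R]_(n, d) | chart_img i q.1].
  apply: open_nbhs_nbhs; split=> //; apply: open_fst_preimage.
  exact: chart_img_open.
have : nbhs p ((f \o tbundle_param i) @^-1` A).
  by apply: (fc _ _ pi); exact: open_nbhs_nbhs.
by apply: filterS2 => q Aq qi; split.
Qed.

End LocalCoordinates.

(** * Derivatives along the fibres *)

Section FibreDerivative.
Context {R : realType} {d n : nat} {M : ptopologicalType}.
Context {S : oriented_manifold R d M}.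
Implicit Types (j : chart_index S) (f : tbundle S n -> R).

(** [tbundle_param j] is linear on fibres, so the two derivatives are limits of
    the same difference quotients. *)
Lemma derive_fibre_param f j (y : 'rV[R]_d) (B W : 'M[R]_(n, d)) :
  'D_(W *m frame j y) (fun A : 'M[R]_(n, d) => f (chart_inv j y, A))
    (B *m frame j y) = 'D_(0, W) (f \o tbundle_param j) (y, B).
Proof.
apply: (congr1 (fun F : R -> R => lim (F @ 0^'))); apply/funext => h /=.
by rewrite /tbundle_param /= scaler0 add0r mulmxDl scalemxAl.
Qed.

Lemma smooth_fun_differentiable f j (p : 'rV[R]_d * 'M[R]_(n, d)) :
  smooth_fun f -> chart_img j p.1 -> differentiable (f \o tbundle_param j) p.
Proof. by move=> fs pj; have [+ _] := fs j 1; apply. Qed.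

(** The preferred chart of the base point is the one whose frame there is the
    identity.  The right-hand side shows that the derivative is linear in [W]. *)
Lemma derive_fibre f (z : tbundle S n) (W : 'M[R]_(n, d)) : smooth_fun f ->
  'D_W (fun A : 'M[R]_(n, d) => f (z.1, A)) z.2 =
  'd (f \o tbundle_param (chart_at S z.1)) (local_coord (chart_at S z.1) z) (0, W).
Proof.
move=> fs; case: z => x A /=; set c := chart_at S x.
have xc : chart_dom c x by exact: chart_at_dom.
have := derive_fibre_param f c (chart c x) A W.
rewrite frame_chart_at !mulmx1 chartK// => ->.
have -> : local_coord c (x, A) = (chart c x, A) by exact: local_coord_at (x, A).
apply: deriveE; apply: smooth_fun_differentiable => //.
exact: chart_img_chart.
Qed.

Lemma gram_unit (g : riemannian_metric S) x : gram g x \in unitmx.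
Proof.
rewrite -row_free_unit -kermx_eq0; apply/rowV0P => u /sub_kermxP uG.
apply/eqP; apply: contraT => /(gram_posdef g x).
by rewrite uG mul0mx mxE ltxx.
Qed.

(** The gradient is characterized by a choice operator; the choice succeeds
    because the fibre derivative is a linear form in [u] and the Gram matrix,
    being invertible, represents every linear form by a vector. *)
Lemma inner_vgradE (g : riemannian_metric S) (i : 'I_n) f (z : tbundle S n)
    (u : 'rV[R]_d) : smooth_fun f ->
  inner g z.1 u (vgrad g i f z) =
  'D_(delta_mx i 0 *m u) (fun A : 'M[R]_(n, d) => f (z.1, A)) z.2.
Proof.
move=> fs; rewrite /vgrad; set P := mkset _.
suff /(xgetPex 0) h : exists w, P w by exact: (h u).
pose l (v : 'rV[R]_d) : R := 'd (f \o tbundle_param (chart_at S z.1))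
  (local_coord (chart_at S z.1) z) (0, delta_mx i 0 *m v).
pose c : 'cV[R]_d := \col_k l (delta_mx 0 k).
exists (invmx (gram g z.1) *m c)^T => v /=.
have -> := derive_fibre z (delta_mx i 0 *m v) fs.
rewrite /inner trmxK mulmxA mulmxK ?gram_unit// mxE.
transitivity (\sum_k v 0 k * l (delta_mx 0 k)).
  by apply: eq_bigr => k _; rewrite mxE.
have lin : linear_for *%R l.
  move=> a v1 v2; rewrite /l mulmxDr -scalemxAr.
  have -> : (0, a *: (delta_mx i 0 *m v1) + delta_mx i 0 *m v2) =
      a *: (0, delta_mx i 0 *m v1) + (0, delta_mx i 0 *m v2)
      :> 'rV[R]_d * 'M[R]_(n, d).
    by congr (_, _) => /=; rewrite scaler0 addr0.
  by rewrite linearP.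
pose lL : {linear 'rV[R]_d -> R | *%R} :=
  HB.pack l (GRing.isLinear.Build _ _ _ _ _ lin).
rewrite -/(l v) [in RHS](row_sum_delta v) -[l]/(lL : _ -> _) linear_sum.
by apply: eq_bigr => k _; apply: esym; exact: (linearZ_LR lL).
Qed.

(** The Euler operator in the vector [v_i]: the derivative of [f] at [z] when
    [v_i] alone is rescaled, which is the metric-free form of the pairing of
    [v_i] with the gradient of [f]. *)
Definition euler (i : 'I_n) f (z : tbundle S n) : R :=
  'D_(delta_mx i 0 *m row i z.2) (fun A : 'M[R]_(n, d) => f (z.1, A)) z.2.

(** Expanding the direction in the standard basis separates the dependence on
    the direction from that on the base point of the differential; only the
    latter is controlled by smoothness in the sense of [Ck_on]. *)
Lemma euler_param (i : 'I_n) f j (p : 'rV[R]_d * 'M[R]_(n, d)) :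
  smooth_fun f -> chart_img j p.1 ->
  euler i f (tbundle_param j p) =
  \sum_k p.2 i k * 'd (f \o tbundle_param j) p (0, delta_mx i k).
Proof.
case: p => y B fs /= yj; rewrite /euler /= row_mul mulmxA derive_fibre_param.
have -> := deriveE _ (smooth_fun_differentiable (p := (y, B)) fs yj).
have -> : (0, delta_mx i 0 *m row i B) =
    \sum_k B i k *: (0, delta_mx i k) :> 'rV[R]_d * 'M[R]_(n, d).
  rewrite [in LHS](row_sum_delta (row i B)) mulmx_sumr.
  rewrite [RHS]surjective_pairing !(raddf_sum fst, raddf_sum snd) /=.
  congr (_, _); first by rewrite big1// => k _; rewrite scaler0.
  by apply: eq_bigr => k _; rewrite mxE -scalemxAr mul_delta_mx.
rewrite linear_sum /=; apply: eq_bigr => k _.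
by rewrite linearZ.
Qed.

Lemma smooth_fun_continuous f : smooth_fun f -> continuous f.
Proof. by move=> fs; apply: tbundle_continuous => i p pi; exact: (fs i 0). Qed.

Lemma euler_continuous (i : 'I_n) f : smooth_fun f -> continuous (euler i f).
Proof.
move=> fs; apply: tbundle_continuous => j p pj.
pose D := [set q : 'rV[R]_d * 'M[R]_(n, d) | chart_img j q.1].
have oD : open D by apply: open_fst_preimage; exact: chart_img_open.
have coordC k : continuous (fun q : 'rV[R]_d * 'M[R]_(n, d) => q.2 i k).
  move=> q; apply: (@continuous_comp _ _ _ snd (fun A : 'M[R]_(n, d) => A i k)).
    exact: cvg_snd.
  exact: coord_continuous.
suff /(_ p pj) : Ck_on 0 D (euler i f \o tbundle_param j) by [].
pose F (q : 'rV[R]_d * 'M[R]_(n, d)) : R :=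
  \sum_k q.2 i k * 'd (f \o tbundle_param j) q (0, delta_mx i k).
apply: (@Ck_on_eq R _ _ 0 D F) => //.
  by move=> q qj /=; rewrite euler_param.
apply: Ck_on_sum => // k; apply: Ck_onM => //.
  by move=> q _; exact: coordC.
by have [_] := fs j 1; apply.
Qed.

End FibreDerivative.

(** * Bump functions on T^nM *)

Section Bump.
Context {R : realType} {d n : nat} {M : ptopologicalType}.
Context {S : oriented_manifold R d M}.
Variables (c : chart_index S) (p0 : 'rV[R]_d * 'M[R]_(n, d)) (r : R).
Implicit Types (p : 'rV[R]_d * 'M[R]_(n, d)) (z : tbundle S n).

(** The bump lives over one chart [c].  Its support is contained in the image of
    a cube around the coordinates [p0] of its centre; [dip] is a polynomial that
    is positive at [p0] and negative outside that cube. *)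
Definition cube : set ('rV[R]_d * 'M[R]_(n, d)) :=
  [set y : 'rV[R]_d | forall i j, `|y i j - p0.1 i j| <= r] `*`
  [set B : 'M[R]_(n, d) | forall i j, `|B i j - p0.2 i j| <= r].

Definition dip p : R :=
  r ^+ 2 - \sum_i \sum_j (p.1 i j - p0.1 i j) ^+ 2
         - \sum_i \sum_j (p.2 i j - p0.2 i j) ^+ 2.

Definition bump z : R :=
  if `[< chart_dom c z.1 >] then flat 0 (dip (local_coord c z)) else 0.

(** The closed set where [dip] is nonnegative, rather than the open set where
    the bump is positive: outside of it the bump vanishes locally, which settles
    smoothness away from the chart [c]. *)
Definition bump_carrier : set (tbundle S n) :=
  [set z | chart_dom c z.1 /\ 0 <= dip (local_coord c z)].

Lemma compact_cube : compact cube.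
Proof. by apply: compact_setX; exact: compact_mx_cube. Qed.

Lemma bump_itv z : 0 <= bump z <= 1.
Proof.
by rewrite /bump; case: ifP => _; [exact: flat0_itv|rewrite lexx ler01].
Qed.

Lemma bump_neq0 z : bump z != 0 -> bump_carrier z.
Proof.
rewrite /bump; case: ifPn => [/asboolP zc h|_ /eqP//]; split=> //.
by rewrite leNgt; apply: contra h => /ltW/flat0_le0 ->.
Qed.

Lemma bump_center : 0 < r -> chart_img c p0.1 -> 0 < bump (tbundle_param c p0).
Proof.
move=> r0 p0c; have [cp0 _] := chart_imgP p0c.
rewrite /bump /= asboolT// tbundle_paramK//; apply: flat0_gt0.
rewrite /dip !big1 ?subr0 ?exprn_gt0// => i _; rewrite big1// => j _;
  by rewrite subrr expr0n.
Qed.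

Context (r0 : 0 < r) (cube_img : forall p, cube p -> chart_img c p.1).

Lemma dip_cube p : 0 <= dip p -> cube p.
Proof.
have sq_ge0 m k (A B : 'M[R]_(m, k)) : 0 <= \sum_i \sum_j (A i j - B i j) ^+ 2.
  by apply: sumr_ge0 => i _; apply: sumr_ge0 => j _; exact: sqr_ge0.
have entry m k (A B : 'M[R]_(m, k)) : \sum_i \sum_j (A i j - B i j) ^+ 2 <= r ^+ 2 ->
    forall i j, `|A i j - B i j| <= r.
  move=> h i j; rewrite -(@ler_pXn2r _ 2) ?nnegrE ?(ltW r0)//.
  rewrite -normrX ger0_norm ?sqr_ge0//; apply: le_trans h.
  rewrite (bigD1 i)//= (bigD1 j)//= -addrA lerDl addr_ge0//.
    by apply: sumr_ge0 => l _; exact: sqr_ge0.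
  by apply: sumr_ge0 => l _; apply: sumr_ge0 => o _; exact: sqr_ge0.
move=> h; have := sq_ge0 _ _ p.1 p0.1; have := sq_ge0 _ _ p.2 p0.2.
move: h; rewrite /dip => h h1 h2.
by split=> /=; apply: entry; lra.
Qed.

Lemma bump_carrier_param : bump_carrier = tbundle_param c @` [set p | 0 <= dip p].
Proof.
apply/seteqP; split=> [z [zc qz]|_ [p qp <-]] /=.
  by exists (local_coord c z) => //; exact: local_coordK.
have pc := cube_img (dip_cube qp); have [pcM _] := chart_imgP pc.
by split=> //; rewrite tbundle_paramK.
Qed.

(** Read in another chart [i], the coordinates of the chart [c] are given by the
    transition map and, on vectors, by its differential. *)
Lemma Ck_on_dip_local_coord k (i : chart_index S) :
  Ck_on k [set p | overlap i c p.1] (fun p => dip (local_coord c (tbundle_param i p))).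
Proof.
set W := mkset _; have oo : open (overlap i c) by exact: open_overlap.
have oW : open W by exact: open_fst_preimage.
pose T := transition i c.
pose q p := r ^+ 2 - \sum_a \sum_b (T p.1 a b - p0.1 a b) ^+ 2
  - \sum_a \sum_b
      ((\sum_l p.2 a l * ('d T (p.1) (delta_mx 0 l)) 0 b) - p0.2 a b) ^+ 2.
apply: (@Ck_on_eq _ _ _ _ _ q) => //.
  move=> p Wp; rewrite local_coord_transition//.
  rewrite /q /dip /=; congr (_ - _).
  apply: eq_bigr => a _; apply: eq_bigr => b _; congr ((_ - _) ^+ 2).
  rewrite mxE; apply: eq_bigr => l _; congr (_ * _).
  have /= <- := mul_jacobian T p.1 (delta_mx 0 l).
  by rewrite -rowE mxE.
have CT j : Ck_on j (overlap i c) T := transition_smooth i c j.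
apply: Ck_onB => //.
  apply: Ck_onB => //; first exact: Ck_on_cst.
  apply: Ck_on_sum => // a; apply: Ck_on_sum => // b.
  apply: Ck_onX2 => //; apply: Ck_onB => //; last exact: Ck_on_cst.
  apply: (Ck_on_fst oo (f := fun y => T y a b)).
  exact: Ck_on_coord.
apply: Ck_on_sum => // a; apply: Ck_on_sum => // b.
apply: Ck_onX2 => //; apply: Ck_onB => //; last exact: Ck_on_cst.
apply: Ck_on_sum => // l; apply: Ck_onM => //.
  apply: Ck_on_coord => //; exact: Ck_on_snd.
apply: (Ck_on_fst oo (f := fun y => ('d T y (delta_mx 0 l)) 0 b)).
by apply: Ck_on_coord => //; have [_] := CT k.+1; apply.
Qed.

(** Closedness is tested in every chart [i].  Near a point whose base lies in the
    domain of [c] it is continuity of [dip].  The other points are kept away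
    from the carrier because the carrier projects into the image in [M] of a
    compact cube, which is closed as [M] is Hausdorff, and which lies in the
    domain of [c]. *)
Lemma closed_bump_carrier : hausdorff_space M -> closed bump_carrier.
Proof.
move=> hM; rewrite -openC.
rewrite -[open _]/(tbundle_open (~` bump_carrier)) => i.
rewrite openE => p [pi pN]; rewrite /interior.
have [pc|pc] := pselect (chart_dom c (chart_inv i p.1)).
  have pO : overlap i c p.1 by rewrite overlapE.
  have nO : nbhs p [set p | overlap i c p.1].
    apply: open_nbhs_nbhs; split=> //; apply: open_fst_preimage.
    exact: open_overlap.
  have q0 : dip (local_coord c (tbundle_param i p)) < 0.
    by rewrite ltNge; apply/negP => h; apply: pN.
  have qC := @Ck_on_dip_local_coord 0 i p pO.
  have : \forall q \near p, dip (local_coord c (tbundle_param i q)) < 0.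
    exact: (qC [set t | t < 0] (lt_nbhsl q0)).
  move=> qneg; apply: (@filterS2 _ _ (nbhs_filter p) _ _ _ _ nO qneg) => q.
  move=> qW qlt.
  have [qi _] : chart_img i q.1 /\ chart_dom c (chart_inv i q.1).
    by move: qW; rewrite [X in X -> _]/= overlapE.
  split; first exact: qi.
  by case=> _ qge; move: (le_lt_trans qge qlt); rewrite ltxx.
pose C := chart_inv c @` (fst @` cube).
have cubeC y : (fst @` cube) y -> chart_img c y by move=> [q /cube_img qc <-].
have cC : compact C.
  apply: continuous_compact.
    by apply: continuous_in_subspaceT => y /set_mem /cubeC; exact: chart_inv_continuous.
  apply: continuous_compact; last exact: compact_cube.
  by apply: continuous_subspaceT => q; exact: cvg_fst.
have oC : open (~` C) by rewrite openC; exact: compact_closed.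
have : nbhs p [set q : 'rV[R]_d * 'M[R]_(n, d) |
    chart_img i q.1 /\ (~` C) (chart_inv i q.1)].
  apply: open_nbhs_nbhs; split.
    by apply: (open_fst_preimage (D := [set y | chart_img i y /\ (~` C) (chart_inv i y)]));
      exact: open_chart_inv.
  split=> // -[y /cubeC /chart_imgP[yc _] yE]; apply: pc; by rewrite -yE.
apply: filterS => q [qi qC]; split; first exact: qi.
move=> [qc qq]; apply: qC.
exists (chart c (chart_inv i q.1)); last by rewrite chartK.
by exists (local_coord c (tbundle_param i q)) => //; exact: dip_cube.
Qed.

Lemma compact_bump_carrier : compact bump_carrier.
Proof.
rewrite bump_carrier_param; set K := mkset _.
have -> : K = K `&` cube by apply/esym/setIidl => p; exact: dip_cube.
apply: continuous_compact.
  apply: continuous_in_subspaceT => p /set_mem[_ /cube_img pc].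
  move=> O; rewrite !nbhsE => -[G [oG Gp] Gsub].
  exists [set q | chart_img c q.1 /\ G (tbundle_param c q)].
    by split; [exact: open_tbundle_param|split].
  by move=> q [_ /Gsub].
apply: subclosed_compact compact_cube _; last by move=> p [].
apply: closedI; last first.
  by apply: compact_closed compact_cube; exact: norm_hausdorff.
suff dipC : continuous dip.
  rewrite (_ : K = dip @^-1` [set t | 0 <= t]) //.
  by apply: closed_comp; [move=> p _; exact: dipC|exact: closed_ge].
have oT : open [set: 'rV[R]_d * 'M[R]_(n, d)] by exact: openT.
suff H : Ck_on 0 setT dip by move=> p; exact: H.
apply: Ck_onB => //.
  apply: Ck_onB => //; first exact: Ck_on_cst.
  apply: Ck_on_sum => // a; apply: Ck_on_sum => // b.
  apply: Ck_onX2 => //; apply: Ck_onB => //; last exact: Ck_on_cst.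
  move=> p _; apply: (@continuous_comp _ _ _ fst (fun A : 'rV[R]_d => A a b)).
    exact: cvg_fst.
  exact: coord_continuous.
apply: Ck_on_sum => // a; apply: Ck_on_sum => // b.
apply: Ck_onX2 => //; apply: Ck_onB => //; last exact: Ck_on_cst.
move=> p _; apply: (@continuous_comp _ _ _ snd (fun A : 'M[R]_(n, d) => A a b)).
  exact: cvg_snd.
exact: coord_continuous.
Qed.

(** In a chart [i] the domain is covered by the open set where [c] is also
    available, on which the bump is [flat 0] of a smooth function, and the
    open complement of the carrier, on which it is zero. *)
Lemma smooth_bump : hausdorff_space M -> smooth_compact_support bump.
Proof.
move=> hM; have cN := closed_bump_carrier hM; split; last first.
  apply: subclosed_compact compact_bump_carrier _; first exact: closed_closure.
  move/closure_id: cN => ->; apply: closure_subset => z; exact: bump_neq0.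
move=> i k; pose W := [set p : 'rV[R]_d * 'M[R]_(n, d) | overlap i c p.1].
pose E := [set p | chart_img i p.1 /\ (~` bump_carrier) (tbundle_param i p)].
have oE : open E by apply: open_tbundle_param; rewrite openC.
have oW : open W by apply: open_fst_preimage; exact: open_overlap.
apply: (@Ck_onS _ _ _ _ (W `|` E)).
  move=> p /= pi.
  have [[pc _]|pN] := pselect (bump_carrier (tbundle_param i p)).
    by left; rewrite /W /= overlapE.
  by right.
apply: Ck_on_setU.
  apply: Ck_on_eq (Ck_on_comp_scalar oW (smooth_flat 0) (Ck_on_dip_local_coord k i)) => //.
  by move=> p; rewrite /W /= overlapE => -[_ pc]; rewrite /bump asboolT.
apply: Ck_on_eq (Ck_on_cst k (0 : R) oE) => // p [_ pN] /=.
by apply/esym/eqP; apply: contraT => /bump_neq0.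
Qed.

End Bump.

Lemma exists_bump (R : realType) (d n : nat) (M : ptopologicalType)
    (S : oriented_manifold R d M) (z0 : tbundle S n) (U : set (tbundle S n)) :
  hausdorff_space M -> open U -> U z0 ->
  exists s : tbundle S n -> R, [/\ smooth_compact_support s,
    forall z, 0 <= s z <= 1, 0 < s z0 & forall z, s z != 0 -> U z].
Proof.
move=> hM oU Uz0; pose c := chart_at S z0.1.
have z0c : chart_dom c z0.1 by exact: chart_at_dom.
pose p0 := local_coord c z0.
have p0c : chart_img c p0.1 by exact: chart_img_chart.
have p0K : tbundle_param c p0 = z0 by exact: local_coordK.
have : nbhs p0 [set p | chart_img c p.1 /\ U (tbundle_param c p)].
  by apply: open_nbhs_nbhs; split; [exact: open_tbundle_param|rewrite /= p0K].
move=> /nbhs_ballP[e /= e0 eU]; pose r := e / 2.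
have r0 : 0 < r by rewrite divr_gt0.
have cubeU p : cube p0 r p -> chart_img c p.1 /\ U (tbundle_param c p).
  have re : r < e by rewrite /r ltr_pdivrMr// ltr_pMr// ltr1n.
  move=> [p1 p2]; apply: eU; split; split=> // i j;
    by rewrite -ball_normE /= distrC; apply: le_lt_trans re.
have cube_img p : cube p0 r p -> chart_img c p.1 by move=> /cubeU[].
exists (bump c p0 r); split.
- exact: smooth_bump.
- exact: bump_itv.
- by rewrite -p0K; exact: bump_center.
- move=> z /bump_neq0[zc /(dip_cube r0) /cubeU[_]].
  by rewrite local_coordK.
Qed.

(** * Integrals of continuous functions for Borel measures *)

Section BorelMeasure.
Context {R : realType} {T : ptopologicalType}.
Local Notation borel := (g_sigma_algebraType (@open T)).
Variable mu : {measure set borel -> \bar R}.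

Lemma continuous_borel_measurable (f : T -> R) :
  continuous f -> measurable_fun setT (f : borel -> R).
Proof.
move=> /continuousP cf; apply: (measurability _ (measurable_realfun.RGenOpens.measurableE R)).
move=> _ [_ [a [b ->] <-]]; rewrite setTI; apply: sub_sigma_algebra.
by apply: cf; exact: interval_open.
Qed.

Lemma continuous_bounded_integrable (f : T -> R) (b : R) :
  (mu setT < +oo)%E -> continuous f -> (forall z, `|f z| <= b) ->
  mu.-integrable setT (EFin \o f : borel -> \bar R).
Proof.
move=> mu_fin cf fb; apply: measurable_bounded_integrable => //.
  exact: continuous_borel_measurable.
exists b; split; first exact: num_real.
by move=> t /ltW bt z _ /=; exact: le_trans bt.
Qed.

(** If the integral vanished, [f] would vanish almost everywhere; but [f] is
    positive on an open set around a point of the support. *)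
Lemma Rintegral_gt0 (f : T -> R) (z0 : T) :
  continuous f -> (forall z, 0 <= f z) -> 0 < f z0 ->
  mu.-integrable setT (EFin \o f : borel -> \bar R) ->
  (forall U : set T, open U -> U z0 -> (0 < mu U)%E) ->
  0 < \int[mu]_z f z.
Proof.
move=> cf f0 fz0 fi muU.
rewrite lt_neqAle Rintegral_ge0 ?andbT; last by move=> z _; exact: f0.
rewrite eq_sym; apply/negP => /eqP int0.
have mf := measurable_int mu fi.
have abs0 : (\int[mu]_z `|(EFin \o f) z| = 0)%E.
  under eq_integral do rewrite /= ger0_norm//.
  by rewrite -(fineK (integrable_fin_num _ fi))// -[fine _]/(\int[mu]_z f z) int0.
pose U := [set z | 0 < f z].
have oU : open U by move/continuousP: cf => /(_ [set t | 0 < t]); apply; exact: open_gt.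
have /(ae_eq_integral_abs mu measurableT mf) [N [mN N0 fN]] := abs0.
have := muU U oU fz0; apply/negP; rewrite -leNgt -N0.
apply: le_measure; rewrite ?inE//; first exact: sub_sigma_algebra.
move=> z Uz; apply: fN => /= /(_ I) [fz]; by move: Uz; rewrite /U /= fz ltxx.
Qed.

End BorelMeasure.

(** * Transpositional variations *)

Section TranspositionalVariation.
Context {R : realType} {d n : nat} {M : ptopologicalType}.
Context {S : oriented_manifold R d M} (g : riemannian_metric S).
Variable mu : {measure set (borel_tbundle S n) -> \bar R}.

Lemma smooth_compact_supportZ (a : R) (s : tbundle S n -> R) :
  smooth_compact_support s -> smooth_compact_support (fun z => a * s z).
Proof.
move=> [s_smooth s_supp]; split.
  move=> i k; have oD : open [set p : 'rV[R]_d * 'M[R]_(n, d) | chart_img i p.1].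
    by apply: open_fst_preimage; exact: chart_img_open.
  exact: Ck_onM oD (Ck_on_cst k a oD) (s_smooth i k).
apply: subclosed_compact s_supp _; first exact: closed_closure.
apply: closure_subset => z /=; apply: contra => /eqP ->; by rewrite mulr0.
Qed.

Lemma transp_variationE (L : tbundle S n -> R) (i : 'I_n) (s : tbundle S n -> R) :
  smooth_fun L ->
  mu.-integrable setT (EFin \o s) ->
  mu.-integrable setT (EFin \o (fun z => s z * L z)) ->
  mu.-integrable setT (EFin \o (fun z => s z * euler i L z)) ->
  transp_variation g mu s i L =
  \int[mu]_z (s z * (L z - euler i L z - action mu L)).
Proof.
move=> Ls si sLi sEi.
have siA : mu.-integrable setT (EFin \o (fun z => action mu L * s z)).
  exact: (integrableZl measurableT (action mu L) si).
rewrite /transp_variation.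
under [X in _ - X - _]eq_Rintegral do rewrite (inner_vgradE g i _ _ Ls) -/(euler i L _).
rewrite -/(action mu L) -RintegralZl// -RintegralB// -RintegralB//.
  by apply: eq_Rintegral => z _; ring.
exact: (integrableB measurableT sLi sEi).
Qed.

End TranspositionalVariation.

Theorem proposition30 (R : realType) (d n : nat) (hn : (1 <= n <= d)%N)
    (M : ptopologicalType) (hM : hausdorff_space M) (cM : compact [set: M])
    (S : oriented_manifold R d M) (g : riemannian_metric S)
    (L : tbundle S n -> R) (hL : smooth_fun L)
    (mu : {measure set (borel_tbundle S n) -> \bar R})
    (hol : holonomic g mu)
    (finA : mu.-integrable setT (EFin \o L))
    (crit : transp_critical g mu L) :
  forall i : 'I_n,
    measure_support mu `<=`
    [set z : tbundle S n |
      inner g z.1 (row i z.2) (vgrad g i L z) - L z = - action mu L].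
Proof.
move=> i z z_supp /=; rewrite (inner_vgradE g i z _ hL) -/(euler i L z).
set A := action mu L; pose F y := L y - euler i L y - A.
suff : F z = 0 by rewrite /F => ?; lra.
apply: contrapT => /eqP Fz.
have LC := smooth_fun_continuous hL; have EC : continuous (euler i L) by exact: euler_continuous.
have FC : continuous F.
  by move=> y; exact: (cvgB (cvgB (LC y) (EC y)) (cvg_cst A)).
(* multiplying by the sign of [F z] treats both signs with the same bump *)
pose k := Num.sg (F z).
have kFC : continuous (fun y => k * F y).
  by move=> y; exact: (cvgM (cvg_cst k) (FC y)).
(* on [U] the functions [L] and [euler i L] are bounded, so that their products
   with a bump supported in [U] are integrable *)
pose U := [set y | 0 < k * F y] `&`
  ([set y | `|L y| < `|L z| + 1] `&` [set y | `|euler i L y| < `|euler i L z| + 1]).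
have oU : open U.
  have open_norm_lt (f : tbundle S n -> R) b : continuous f -> open [set y | `|f y| < b].
    move=> fC; have /continuousP h : continuous (fun y => `|f y|).
      by move=> y; exact: (cvg_norm (fC y)).
    exact: (h _ (@open_lt _ b)).
  apply: openI; last by apply: openI; exact: open_norm_lt.
  by move/continuousP: kFC => h; exact: (h _ (@open_gt _ 0)).
have Uz : U z.
  by split; [rewrite /= /k -normrEsg normr_gt0|split; rewrite /= ltrDl].
have [s [s_supp s01 sz sU]] := exists_bump hM oU Uz.
have sC : continuous s by apply: smooth_fun_continuous; case: s_supp.
have mu_fin : (mu setT < +oo)%E by case: hol => _ -> _; exact: ltry.
have k1 : `|k| <= 1 by rewrite normr_sg; case: (_ != 0).
have ks_bound (f : tbundle S n -> R) (b : R) : 0 <= b ->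
    (forall y, U y -> `|f y| <= b) -> forall y, `|- k * s y * f y| <= b.
  move=> b0 fb y; have [->|/sU/fb fyb] := eqVneq (s y) 0.
    by rewrite mulr0 mul0r normr0.
  have /andP[s0 s1] := s01 y; rewrite !normrM normrN (ger0_norm s0).
  rewrite -[leRHS]mul1r ler_pM ?mulr_ge0// -[leRHS]mulr1.
  by rewrite ler_pM.
have ksC (f : tbundle S n -> R) : continuous f -> continuous (fun y => - k * s y * f y).
  by move=> fC y; exact: (cvgM (cvgM (cvg_cst (- k)) (sC y)) (fC y)).
have int_ks f b : continuous f -> 0 <= b -> (forall y, U y -> `|f y| <= b) ->
    mu.-integrable setT (EFin \o (fun y => - k * s y * f y)).
  move=> fC b0 fb; apply: (@continuous_bounded_integrable _ _ mu _ b) => //.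
    exact: ksC.
  exact: ks_bound.
have int1 : mu.-integrable setT (EFin \o (fun y => - k * s y)).
  have := int_ks (fun=> 1) 1; rewrite (_ : (fun y => _ * 1) = fun y => - k * s y).
    apply; [exact: cst_continuous|exact: ler01|].
    by move=> y _; rewrite normr1.
  by apply/funext => y; rewrite mulr1.
have intL : mu.-integrable setT (EFin \o (fun y => - k * s y * L y)).
  by apply: (int_ks _ (`|L z| + 1)) => // y [_ [/ltW]].
have intE : mu.-integrable setT (EFin \o (fun y => - k * s y * euler i L y)).
  by apply: (int_ks _ (`|euler i L z| + 1)) => // y [_ [_ /ltW]].
(* the test function [- k * s] is chosen to make the variation negative *)
have := crit _ i (smooth_compact_supportZ (- k) s_supp).
rewrite transp_variationE// -/A; apply/negP; rewrite -ltNge.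
have intF : mu.-integrable setT (EFin \o (fun y => - k * s y * F y)).
  apply: (int_ks _ (`|L z| + 1 + (`|euler i L z| + 1) + `|A|)) => // y.
  move=> [_ [/= /ltW yL /ltW yE]]; rewrite /F.
  apply: (le_trans (ler_normB _ _)); rewrite lerD2r.
  by apply: (le_trans (ler_normB _ _)); exact: lerD.
rewrite -oppr_gt0 -mulN1r -RintegralZl//.
apply: (@Rintegral_gt0 _ _ _ (fun y => -1 * (- k * s y * F y)) z) => //.
- by move=> y; exact: (cvgM (cvg_cst (-1 : R)) (ksC F FC y)).
- move=> y; have [->|sy] := eqVneq (s y) 0; first by rewrite mulr0 mul0r mulr0.
  have [/= kF _] := sU _ sy; have /andP[s0 _] := s01 y.
  by rewrite !mulNr mul1r opprK mulrAC mulr_ge0// ltW.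
- by rewrite !mulNr mul1r opprK mulrAC mulr_gt0//; case: Uz.
- exact: (integrableZl measurableT (-1) intF).
Qed.
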